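(* Let $(A_i)_{i=1}^\infty$ be an infinite sequence of events in a probability space with probability measure $\mathbb{P}$. Let $\omega \colon \mathbb{N}^+ \to \mathbb{N}^+$ be such that for all $N \in \mathbb{N}^+$ \[ \sum_{i=1}^{\omega(N)} \mathbb{P}[A_i] \geq N. \] Then, for all $m, \ell \in \mathbb{N}$ and all $g \colon \mathbb{N}^+ \to \mathbb{N}^+$ such that $g(i) > i$ for all $i$, there exists an $n > m$ such that \[ n \leq g^{(2^{\ell+1})}\left(\max\left(\omega\left(\left\lceil 2^{\ell+2} \sum_{i=1}^m \mathbb{P}[A_i] \right\rceil\right), m\right)\right) \] and, for all integers $j \in [n, g(n)]$, \[ \mathbb{P}\left[\bigcup_{i=m+1}^n A_i\right] + \frac{1}{2^\ell} \geq \frac{\left(\sum_{i=1}^j \mathbb{P}[A_i]\right)^2}{\sum_{i,k=1}^j \mathbb{P}[A_i A_k]}. \]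
   Context: $\mathbb{N}$ denotes the non-negative integers and $\mathbb{N}^+$ the positive integers. $A_i A_k$ denotes $A_i \cap A_k$, and $\sum_{i,k=1}^{j}$ is the sum over all pairs $(i,k)$ with $1 \le i,k \le j$. $g^{(r)}$ denotes the $r$-fold iterate of $g$. Conventions for degenerate cases: $\omega(0) := 1$ (relevant only when $\sum_{i=1}^m \mathbb{P}[A_i] = 0$), and a quotient $0/0$ is read as $0$ (the denominator on the right-hand side vanishes only if the numerator does). *)

(* Defs.v *)
From HB Require Import structures.
From mathcomp Require Import all_boot all_order all_algebra.
From mathcomp Require Import all_classical all_reals all_analysis.

Set Implicit Arguments.
Unset Strict Implicit.
Unset Printing Implicit Defensive.

Import Order.TTheory GRing.Theory Num.Theory.
Import numFieldNormedType.Exports.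

Local Open Scope classical_set_scope.
Local Open Scope ring_scope.

(* Real-valued probability; [fine] loses nothing since [0 <= P A <= 1]. *)
Definition pr (d : measure_display) (T : measurableType d) (R : realType)
  (P : probability T R) (A : set T) : R := fine (P A).

(* A function [N^+ -> N^+] is encoded as [nat -> nat] with hypotheses on
   positive arguments only; [extend0] replaces the arbitrary value at 0 by the
   conventional [omega(0) := 1]. *)
Definition extend0 (omega : nat -> nat) (N : nat) : nat :=
  if N is 0%N then 1%N else omega N.

(* Main.v *)
(* Write S_j for the partial sums of the P[A_i], D_j for the double sum up to j
   and V_j for the probability of the union of the A_i with m < i <= j. The
   Chung-Erdos inequality for this union gives (S_j - S_m)^2 <= V_j D_j. Once
   S_j >= 2^(l+2) S_m, dropping the first m events costs little, and
   S_j^2 / D_j <= V_j + 2^-(l+1). Hence if n fails with a witness j in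
   [n, g n], then V increases by more than 2^-(l+1) between n and g n; this
   cannot happen at 2^(l+1) successive iterates of g, as V is at most 1. *)

Require Import Defs.
From HB Require Import structures.
From mathcomp Require Import all_boot all_order all_algebra.
From mathcomp Require Import all_classical all_reals all_analysis.
From mathcomp Require Import ring lra.

Set Implicit Arguments.
Unset Strict Implicit.
Unset Printing Implicit Defensive.

Import Order.TTheory GRing.Theory Num.Theory.
Import numFieldNormedType.Exports.

Local Open Scope classical_set_scope.
Local Open Scope ring_scope.

Section Pr.
Context (R : realType) (d : measure_display) (T : measurableType d).
Variable P : probability T R.

Lemma pr_ge0 B : 0 <= pr P B.
Proof. exact: fine_ge0. Qed.

Lemma prE B : measurable B -> (pr P B)%:E = P B.
Proof. by move=> mB; rewrite /pr fineK ?fin_num_measure. Qed.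

Lemma pr_le1 B : measurable B -> pr P B <= 1.
Proof. by move=> mB; rewrite -lee_fin prE ?probability_le1. Qed.

Lemma le_pr B C : measurable B -> measurable C -> B `<=` C ->
  pr P B <= pr P C.
Proof. by move=> mB mC BC; rewrite -lee_fin !prE ?le_measure ?inE. Qed.

(* The sum is the expectation of the square of [\sum_i c i * \1_(B i)]. *)
Lemma gram_pr_ge0 I (r : seq I) (c : I -> R) (B : I -> set T) :
  (forall i, measurable (B i)) ->
  0 <= \sum_(i <- r) \sum_(k <- r) c i * c k * pr P (B i `&` B k).
Proof.
move=> mB.
have iI i k :
    P.-integrable setT (fun x => (c i * c k)%:E * (\1_(B i `&` B k) x)%:E)%E.
  by apply/integrableZl/integrable_indic => //; exact: measurableI.
rewrite -lee_fin.
suff <- : (\int[P]_x (\sum_(i <- r) \sum_(k <- r)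
      ((c i * c k)%:E * (\1_(B i `&` B k) x)%:E)) =
    (\sum_(i <- r) \sum_(k <- r) c i * c k * pr P (B i `&` B k))%:E)%E.
  apply/integral_ge0 => x _.
  rewrite (_ : (\sum_(i <- r) _)%E =
      ((\sum_(i <- r) c i * \1_(B i) x) ^+ 2)%:E).
    by rewrite lee_fin sqr_ge0.
  rewrite expr2 big_distrl/= -sumEFin; apply: eq_bigr => i _.
  rewrite big_distrr/= -sumEFin; apply: eq_bigr => k _.
  by rewrite indicI -EFinM mulrACA.
rewrite integral_sum//; last by move=> i; exact: integrable_sum.
rewrite -sumEFin; apply: eq_bigr => i _.
rewrite integral_sum// -sumEFin; apply: eq_bigr => k _.
rewrite integralZl//; last by apply: integrable_indic => //; exact: measurableI.
by rewrite integral_indic ?setIT ?EFinM ?prE//; exact: measurableI.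
Qed.

(** This is Cauchy-Schwarz for the sum of the indicators, which vanishes off [U], against [\1_U]; it
    follows from a quadratic in a real [t] that is nonnegative everywhere. *)
Lemma chung_erdos (I : eqType) (r : seq I) (B : I -> set T) (U : set T) :
  measurable U -> {in r, forall i, measurable (B i)} ->
  {in r, forall i, B i `<=` U} ->
  (\sum_(i <- r) pr P (B i)) ^+ 2 <=
    pr P U * \sum_(i <- r) \sum_(k <- r) pr P (B i `&` B k).
Proof.
move=> mU mB BU.
set D := \sum_(i <- r) \sum_(k <- r) _; set S := \sum_(i <- r) pr P (B i).
(* Expectation of [(\sum_(i <- r) \1_(B i) - t * \1_U) ^+ 2]. *)
have quad t : 0 <= D - 2 * t * S + t ^+ 2 * pr P U.
  (* [None] carries [U] with coefficient [- t]. Outside [r] the value [set0] makes every [B' i]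
     measurable, as [gram_pr_ge0] requires. *)
  pose B' i := if i is Some i then if i \in r then B i else set0 else U.
  pose c (i : option I) : R := if i is Some _ then 1 else - t.
  have mB' i : measurable (B' i).
    by case: i => [i|//] /=; case: ifPn => // /mB.
  have := gram_pr_ge0 (None :: map Some r) c mB'.
  have -> : \sum_(i <- None :: map Some r) \sum_(k <- None :: map Some r)
      c i * c k * pr P (B' i `&` B' k) = D - 2 * t * S + t ^+ 2 * pr P U => //.
  rewrite big_cons big_map big_cons big_map /= setIid.
  have -> : \sum_(i <- r) - t * 1 *
      pr P (U `&` (if i \in r then B i else set0)) = - t * S.
    rewrite mulr_sumr [LHS]big_seq [RHS]big_seq; apply: eq_bigr => i ir.
    by rewrite ir mulr1 (setIidr (BU _ ir)).
  under eq_bigr do rewrite big_cons big_map.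
  rewrite big_split /=.
  have -> : \sum_(i <- r) 1 * - t *
      pr P ((if i \in r then B i else set0) `&` U) = - t * S.
    rewrite mulr_sumr [LHS]big_seq [RHS]big_seq; apply: eq_bigr => i ir.
    by rewrite ir mul1r (setIidl (BU _ ir)).
  rewrite (_ : \sum_(i <- r) _ = D); first by ring.
  rewrite [LHS]big_seq /D [RHS]big_seq; apply: eq_bigr => i ir.
  rewrite [LHS]big_seq [RHS]big_seq; apply: eq_bigr => k kr.
  by rewrite ir kr !mul1r.
have [U0|U0] := eqVneq (pr P U) 0.
  suff -> : S = 0 by rewrite U0 mul0r expr0n.
  rewrite /S big_seq big1// => i ir; apply/eqP; rewrite eq_le pr_ge0 andbT -U0.
  by apply: le_pr; [exact: mB|exact: mU|exact: BU].
have {}U0 : 0 < pr P U by rewrite lt_neqAle eq_sym U0 pr_ge0.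
(* The minimiser of the quadratic; multiplied by [pr P U], its value there is
   [pr P U * D - S ^+ 2]. *)
have := quad (S / pr P U).
rewrite -(pmulr_rge0 _ U0) => h; rewrite -subr_ge0; apply: le_trans h _.
rewrite le_eqVlt; apply/orP; left; apply/eqP; field.
by rewrite gt_eqF.
Qed.


Section Window.
Variable A : nat -> set T.
Hypothesis mA : forall i, (0 < i)%N -> measurable (A i).

Local Notation S j := (\sum_(1 <= i < j.+1) pr P (A i)).
Local Notation D j :=
  (\sum_(1 <= i < j.+1) \sum_(1 <= k < j.+1) pr P (A i `&` A k)).
Local Notation V m j := (pr P (\bigcup_(i in [set i | (m < i <= j)%N]) A i)).

Lemma measurable_window m j :
  measurable (\bigcup_(i in [set i | (m < i <= j)%N]) A i).
Proof.
by apply: bigcup_measurable => i /= /andP[/(leq_trans _) h _]; exact/mA/h.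
Qed.

Lemma le_window m j k : (j <= k)%N -> V m j <= V m k.
Proof.
move=> jk; apply: le_pr; [exact: measurable_window..|].
by apply: bigcup_subset => i /= /andP[-> /leq_trans->].
Qed.

Lemma le_sum_nat (F : nat -> R) m j : (forall i, 0 <= F i) ->
  (0 < m <= j.+1)%N -> \sum_(m <= i < j.+1) F i <= \sum_(1 <= i < j.+1) F i.
Proof.
move=> F0 /andP[m0 mj]; rewrite (big_cat_nat m0 mj) /= lerDr.
exact: sumr_ge0.
Qed.

Lemma le_partial_sum j k : (j <= k)%N -> S j <= S k.
Proof.
move=> jk; rewrite (big_cat_nat (n := j.+1) _ _ (p := k.+1))//= lerDl.
by apply: sumr_ge0 => i _; exact: pr_ge0.
Qed.

Lemma sqr_sum_le_window m j : (m <= j)%N -> (S j - S m) ^+ 2 <= V m j * D j.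
Proof.
move=> mj.
have -> : S j - S m = \sum_(m.+1 <= i < j.+1) pr P (A i).
  by rewrite (big_cat_nat (n := m.+1) _ _ (p := j.+1))//= addrAC subrr add0r.
apply: (@le_trans _ _ (V m j *
    \sum_(m.+1 <= i < j.+1) \sum_(m.+1 <= k < j.+1) pr P (A i `&` A k))).
  apply: chung_erdos; first exact: measurable_window.
    move=> i; rewrite mem_index_iota => /andP[mi _].
    exact/mA/(leq_ltn_trans _ mi).
  by move=> i; rewrite mem_index_iota => ij; exact: bigcup_sup.
(* The terms being nonnegative, the double sum is extended down to index 1, first in [k], then in
   [i]. *)
rewrite ler_wpM2l ?pr_ge0//.
apply: (@le_trans _ _
    (\sum_(m.+1 <= i < j.+1) \sum_(1 <= k < j.+1) pr P (A i `&` A k))).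
  apply: ler_sum => i _; apply: le_sum_nat => // k; exact: pr_ge0.
by apply: le_sum_nat => // i; apply: sumr_ge0 => k _; exact: pr_ge0.
Qed.

(** Since [(S j - S m) ^+ 2 >= S j ^+ 2 - 2 * S m * S j], the loss is at most [2 * S m * S j], hence
    at most [S j ^+ 2 / 2 ^+ l.+1] by hypothesis, and [S j ^+ 2 <= D j]. *)
Lemma ratio_le_window m l j : (m <= j)%N -> 2 ^+ l.+2 * S m <= S j ->
  S j ^+ 2 / D j <= V m j + 1 / 2 ^+ l.+1.
Proof.
move=> mj hS.
have S0 : 0 <= S m by apply: sumr_ge0 => i _; exact: pr_ge0.
have D0 : 0 <= D j by do 2!apply: sumr_ge0 => ? _; exact: pr_ge0.
have h1 := sqr_sum_le_window mj.
have h2 : S j ^+ 2 <= D j.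
  (* The window from 0 has the full sum [S j], and its union has probability at most 1. *)
  have := sqr_sum_le_window (leq0n j); rewrite [X in _ - X]big_geq// subr0.
  move=> /le_trans; apply; rewrite ler_piMl//.
  exact/pr_le1/measurable_window.
have e0 : 0 < 2 ^+ l.+1 :> R by rewrite exprn_gt0.
have V0 : 0 <= V m j by exact: pr_ge0.
(* Division by 0 yields 0, in line with the convention for [0/0]. *)
have [->|Dn0] := eqVneq (D j) 0.
  by rewrite invr0 mulr0 addr_ge0// divr_ge0// ltW.
have Dp : 0 < D j by rewrite lt_neqAle eq_sym Dn0.
rewrite ler_pdivrMr// -subr_ge0 -(pmulr_rge0 _ e0).
rewrite [X in 0 <= X](_ : _ = 2 ^+ l.+1 * (V m j * D j - S j ^+ 2) + D j).
  move: hS h1 h2 e0 S0; rewrite exprS.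
  set e := 2 ^+ l.+1; set s := S j; set t := S m => hS h1 h2 e0 S0.
  have h3 : 2 * e * t * s <= s * s.
    by rewrite ler_wpM2r// (le_trans _ hS)// !mulr_ge0// ltW.
  have h4 : 0 <= e * (V m j * D j - (s - t) ^+ 2).
    by rewrite mulr_ge0 ?subr_ge0// ltW.
  have h5 : 0 <= e * t ^+ 2 by rewrite mulr_ge0 ?sqr_ge0// ltW.
  (* The goal is the sum of [h4], [h5] and the differences of the sides of [h3] and [h2]. *)
  nra.
by field; rewrite gt_eqF.
Qed.

End Window.
End Pr.

Theorem theorem4p3 (R : realType) (d : measure_display) (T : measurableType d)
  (P : probability T R) (A : nat -> set T)
  (mA : forall i, (0 < i)%N -> measurable (A i))
  (omega : nat -> nat)
  (omega_gt0 : forall N, (0 < N)%N -> (0 < omega N)%N)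
  (omegaP : forall N, (0 < N)%N ->
     N%:R <= \sum_(1 <= i < (omega N).+1) pr P (A i))
  (m l : nat) (g : nat -> nat)
  (g_gt : forall i, (0 < i)%N -> (i < g i)%N) :
  exists n : nat,
    [/\ (m < n)%N,
        (n <= iter (2 ^ l.+1) g
                (maxn
                   (extend0 omega
                      `|Num.ceil (2 ^+ l.+2 *
                                  \sum_(1 <= i < m.+1) pr P (A i))|%N)
                   m))%N
      & forall j : nat, (n <= j <= g n)%N ->
          (\sum_(1 <= i < j.+1) pr P (A i)) ^+ 2 /
          (\sum_(1 <= i < j.+1) \sum_(1 <= k < j.+1) pr P (A i `&` A k))
          <= pr P (\bigcup_(i in [set i | (m < i <= n)%N]) A i) + 1 / 2 ^+ l].
Proof.
set N := `|_|%N; set K := maxn _ _.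
have K_gt0 : (0 < K)%N.
  (* For [N = 0] positivity comes from the value 1 of [extend0]. *)
  by rewrite /K leq_max; apply/orP; left; case: (N) => // n; exact: omega_gt0.
have iter_gt0 t : (0 < iter t g K)%N.
  by elim: t => //= t IH; exact: leq_ltn_trans (g_gt _ IH).
have iter_lt t : (iter t g K < iter t.+1 g K)%N by rewrite iterS g_gt.
have iter_le : {homo (fun t => iter t g K) : s t / (s <= t)%N}.
  exact: homo_leq leq_trans (fun t => ltnW (iter_lt t)).
have S_large j : (K <= j)%N ->
    2 ^+ l.+2 * \sum_(1 <= i < m.+1) pr P (A i) <=
      \sum_(1 <= i < j.+1) pr P (A i).
  move=> Kj; set x := _ * _.
  have x0 : 0 <= x.
    by rewrite mulr_ge0 ?exprn_ge0// sumr_ge0// => i _; exact: pr_ge0.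
  have xN : x <= N%:R.
    rewrite /N natr_absz ger0_norm ?ceil_ge//.
    by rewrite ceil_ge0 (lt_le_trans _ x0)// ltrN10.
  apply: (le_trans xN).
  have : (extend0 omega N <= j)%N by rewrite (leq_trans _ Kj)// leq_maxl.
  case: (N) => [|n] /= nj; first by rewrite sumr_ge0// => i _; exact: pr_ge0.
  exact: le_trans (omegaP _ _) (le_partial_sum _ _ nj).
apply: contrapT => none.
pose V n : R := pr P (\bigcup_(i in [set i | (m < i <= n)%N]) A i).
(* The iterate at [t = 0] is left out because [K] may equal [m], whereas [m < n] is required. *)
have step t : (0 < t <= 2 ^ l.+1)%N ->
    V (iter t g K) + 1 / 2 ^+ l.+1 < V (iter t.+1 g K).
  move=> /andP[t0 tl]; rewrite ltNge; apply/negP => small.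
  have Kt : (K < iter t g K)%N.
    exact: leq_trans (iter_lt 0%N) (iter_le _ _ t0).
  apply: none; exists (iter t g K); split; first last.
  - move=> j /andP[tj jt].
    have Kj : (K <= j)%N := leq_trans (ltnW Kt) tj.
    apply: (le_trans (ratio_le_window mA _ (S_large _ Kj))).
      exact: leq_trans (leq_maxr _ _) Kj.
    (* If [V] grows by at most [1 / 2 ^+ l.+1] up to [g n], this growth and the equal error of
       [ratio_le_window] add up to [1 / 2 ^+ l]. *)
    have := le_window P mA m jt.
    move: small; rewrite /V iterS [2 ^+ l.+1]exprS => small le1.
    have -> : 1 / 2 ^+ l = 1 / (2 * 2 ^+ l) + 1 / (2 * 2 ^+ l) :> R.
      by field; rewrite gt_eqF// exprn_gt0.
    lra.
  - exact: iter_le.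
  - exact: leq_ltn_trans (leq_maxr _ _) Kt.
have grow t : (t < 2 ^ l.+1)%N -> t%:R / 2 ^+ l.+1 <= V (iter t.+1 g K).
  elim: t => [_|t IH tl]; first by rewrite mul0r; exact: pr_ge0.
  apply: ltW; apply: le_lt_trans (step t.+1 _); last exact: ltnW.
  by rewrite -natr1 mulrDl lerD2r IH// ltnW.
have [t tE] : exists t, (2 ^ l.+1)%N = t.+1.
  by exists (2 ^ l.+1).-1; rewrite prednK// expn_gt0.
have e0 : (2 ^ l.+1)%:R != 0 :> R by rewrite pnatr_eq0 tE.
(* [grow] stops one step short of [2 ^ l.+1]; the last step is taken here to keep its strict
   inequality. *)
have lt1 : 1 < V (iter t.+2 g K).
  have tV : t%:R / 2 ^+ l.+1 <= V (iter t.+1 g K) by apply: grow; rewrite tE.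
  apply: le_lt_trans (step t.+1 _); last by rewrite tE leqnn.
  apply: le_trans (lerD tV (lexx _)).
  by rewrite -mulrDl natr1 -natrX -tE divff.
by move: lt1; rewrite ltNge => /negP; apply; exact/pr_le1/measurable_window.
Qed.
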